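(* Let $A$ be an abelian group and let $\mathcal{U}$ be the ring topology on $\mathrm{End} A$ associated with the Bohr topology of $A$. (i) If $A$ is a torsion-free group of cardinality $\leq 2^{\aleph_0}$, then $(\mathrm{End} A,\mathcal{U})$ is discrete. (ii) If $A$ is a free abelian group of cardinality $>2^{\aleph_0}$, then $(\mathrm{End} A,\mathcal{U})$ is non-discrete.
   Context: The Bohr topology $\mathcal{T}_{Bohr}$ on an abelian group $A$ is the largest precompact group topology on $A$; it is Hausdorff. The ring topology $\mathcal{U}$ on $\mathrm{End} A$ (the ring of endomorphisms of $A$) associated with $\mathcal{T}_{Bohr}$ is the one having as a fundamental system of neighborhoods of zero the sets $P(V)=\{\alpha\in \mathrm{End} A\mid \alpha(A)\subset V\}$, where $V$ runs over all neighborhoods of zero of $(A,\mathcal{T}_{Bohr})$. *)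

(* Defs.v *)
From HB Require Import structures.
From mathcomp Require Import all_boot all_order all_algebra.
From mathcomp Require Import all_classical all_reals all_analysis.

Set Implicit Arguments.
Unset Strict Implicit.
Unset Printing Implicit Defensive.

Import GRing.Theory.

Local Open Scope classical_set_scope.
Local Open Scope ring_scope.

(* A topology on A is a value t of the class [Topological A]; A equipped with
   it is the topological space [Topological.Pack t]. Keeping t first class
   allows quantifying over all topologies on A. *)
Section GroupTopologies.
Variables (A : zmodType) (t : Topological A).
Let At : topologicalType := Topological.Pack t.

Definition group_topology : Prop :=
  continuous (fun z : At * At => ((z.1 : A) + (z.2 : A) : At)) /\
  continuous (fun x : At => (- (x : A) : At)).

(* Precompactness is total boundedness, without a separation requirement. *)
Definition totally_bounded : Prop :=
  forall V : set A, nbhs (0 : At) V ->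
    exists2 F : set A, finite_set F &
      [set: A] `<=` [set x + v | x in F & v in V].

Definition precompact_group_topology : Prop :=
  group_topology /\ totally_bounded.

Lemma group_topology_sub : group_topology -> forall x y : A,
  (fun z : At * At => ((z.1 : A) - (z.2 : A) : At)) @ (nbhs ((x, y) : At * At))
    --> (x - y : At).
Proof.
move=> [addC oppC] x y.
apply: (@continuous_comp _ _ _ (fun z : At * At => (z.1, - (z.2 : A) : At))
  (fun z : At * At => ((z.1 : A) + (z.2 : A) : At)) ((x, y) : At * At));
  last exact: addC.
apply: cvg_pair; first exact: cvg_fst.
by apply: continuous_comp; [exact: cvg_snd|exact: oppC].
Qed.

Lemma group_topology_nbhs0 (V : set A) : group_topology ->
  nbhs (0 : At) V ->
  exists2 W : set A, nbhs (0 : At) W & forall x y, W x -> W y -> V (x - y).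
Proof.
move=> /group_topology_sub/(_ 0 0); rewrite subr0 => cV /cV.
case=> -[/= W1 W2] [W10 W20] sW; exists (W1 `&` W2); first exact: filterI.
by move=> x y [W1x _] [_ W2y]; apply: (sW (x, y)).
Qed.

(* The sets V for which A has a finite partition into V-small pieces. They form
   a filter, which is how total boundedness passes to suprema. *)
Definition coloured (V : set A) : Prop :=
  exists n (k : A -> 'I_n), forall x y, k x = k y -> V (x - y).

Lemma precompact_coloured (V : set A) : precompact_group_topology ->
  nbhs (0 : At) V -> coloured V.
Proof.
move=> [gt tb] /(group_topology_nbhs0 gt)[W /tb[F finF FW] WV].
have /choice[c cP] (x : A) : exists a : A, F a /\ W (x - a).
  have [a Fa [w Ww <-]] := FW x I; exists a; split=> //.
  by rewrite addrC addKr.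
have [s sF] := (finite_seqP _).1 finF; exists (size s).+1.
exists (fun x => inord (index (c x) s)) => x y.
move=> /(congr1 (@nat_of_ord _)); rewrite /= !inordK ?ltnS ?index_size// => kxy.
have cE : c x = c y.
  have cs z : c z \in s by have [] := cP z; rewrite sF.
  by rewrite -(nth_index 0 (cs x)) kxy nth_index.
have [_ Wx] := cP x; have [_ Wy] := cP y.
suff <- : (x - c x) - (y - c y) = x - y by exact: WV.
by rewrite cE opprB addrA subrK.
Qed.

End GroupTopologies.

Lemma coloured_filter (A : zmodType) : Filter (@coloured A).
Proof.
split.
- by exists 1, (fun=> ord0).
- move=> V1 V2 [n1 [k1 V1P]] [n2 [k2 V2P]].
  exists #|{: 'I_n1 * 'I_n2}|, (fun x => enum_rank (k1 x, k2 x)).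
  by move=> x y /enum_rank_inj[kx ky]; split; [exact: V1P|exact: V2P].
- by move=> V1 V2 V12 [n [k kV]]; exists n, k => x y /kV; exact: V12.
Qed.

Lemma coloured_cover (A : zmodType) (V : set A) : coloured V ->
  exists2 F : set A, finite_set F &
    [set: A] `<=` [set x + v | x in F & v in V].
Proof.
move=> [n [k kV]]; pose r i := xget 0 [set x | k x = i].
exists (r @` [set: 'I_n]); first exact: finite_image.
move=> x _; exists (r (k x)); first by exists (k x).
exists (x - r (k x)); last by rewrite addrC subrK.
apply/kV; rewrite /r; case: xgetP => //= H.
by have := H x.
Qed.

(* A with the Bohr topology, built as the supremum of all precompact group
   topologies. [bohr_precompact] and [bohr_largest] show that it is itself a
   precompact group topology, hence the largest one. *)
Definition bohr (A : zmodType) : Type :=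
  sup_topology (fun t : {t : Topological A | precompact_group_topology t} =>
    sval t).

Section Bohr.
Variable A : zmodType.

HB.instance Definition _ := GRing.Zmodule.on (bohr A).
HB.instance Definition _ := Topological.on (bohr A).

Lemma bohr_nbhs (t : Topological A) (x : A) (V : set A) :
  precompact_group_topology t ->
  nbhs (x : Topological.Pack t) V -> nbhs (x : bohr A) V.
Proof.
move=> pt.
have := (@cvg_sup _ _ (fun t : {t | precompact_group_topology t} => sval t)
  (nbhs (x : bohr A)) x _).1.
by move=> /(_ (nbhs_filter _) (fun _ h => h) (exist _ t pt)); exact.
Qed.

Lemma bohr_sub_continuous :
  continuous (fun z : bohr A * bohr A => z.1 - z.2).
Proof.
move=> [x y]; apply/cvg_sup => -[t pt] S /= /(@group_topology_sub _ _ pt.1 x y S).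
case=> -[/= U V] [Ux Vy] sS; exists (U, V) => //=.
by split; exact: (bohr_nbhs pt).
Qed.

HB.instance Definition _ :=
  PreTopologicalNmodule_isTopologicalZmodule.Build (bohr A) bohr_sub_continuous.

Lemma bohr_precompact :
  precompact_group_topology (Topological.on (bohr A) : Topological A).
Proof.
split; first by split; [exact: (@add_continuous (bohr A))
                       |exact: (@opp_continuous (bohr A))].
move=> V V0; apply: coloured_cover.
have := (@cvg_sup _ _ (fun t : {t | precompact_group_topology t} => sval t)
    (@coloured A) 0 (coloured_filter A)).2.
by apply=> // -[t pt] W; exact: precompact_coloured.
Qed.

Lemma bohr_largest (t : Topological A) (U : set A) :
  precompact_group_topology t ->
  @open (Topological.Pack t) U -> @open (bohr A) U.
Proof.
move=> pt oU.
rewrite (@openE (bohr A)) => x Ux; apply: (bohr_nbhs pt).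
exact: open_nbhs_nbhs.
Qed.

End Bohr.

Definition endo (A : zmodType) : Type := {additive A -> A}.

Section EndoRing.
Variable A : zmodType.
Implicit Types f g h : endo A.

HB.instance Definition _ := gen_eqMixin (endo A).
HB.instance Definition _ := gen_choiceMixin (endo A).

Lemma endoP f g : (forall x, f x = g x) -> f = g.
Proof.
case: f g => [f [[fP]]] [g [[gP]]] /= /funext fg.
by case: _ / fg gP => gP; rewrite (Prop_irrelevance fP gP).
Qed.

Definition endo_zero : endo A := (\0 : A -> A) : {additive A -> A}.
Definition endo_opp f : endo A := (\- f) : {additive A -> A}.
Definition endo_add f g : endo A := (f \+ g) : {additive A -> A}.
Definition endo_one : endo A := (@idfun A) : {additive A -> A}.
Definition endo_mul f g : endo A := (f \o g) : {additive A -> A}.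

Fact endo_addA : associative endo_add.
Proof. by move=> f g h; apply: endoP => x /=; rewrite addrA. Qed.
Fact endo_addC : commutative endo_add.
Proof. by move=> f g; apply: endoP => x /=; rewrite addrC. Qed.
Fact endo_add0 : left_id endo_zero endo_add.
Proof. by move=> f; apply: endoP => x /=; rewrite add0r. Qed.
Fact endo_addN : left_inverse endo_zero endo_opp endo_add.
Proof. by move=> f; apply: endoP => x /=; rewrite addNr. Qed.

HB.instance Definition _ :=
  GRing.isZmodule.Build (endo A) endo_addA endo_addC endo_add0 endo_addN.

Fact endo_mulA : associative endo_mul.
Proof. by move=> f g h; apply: endoP. Qed.
Fact endo_mul1 : left_id endo_one endo_mul.
Proof. by move=> f; apply: endoP. Qed.
Fact endo_mulr1 : right_id endo_one endo_mul.
Proof. by move=> f; apply: endoP. Qed.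
Fact endo_mulDl : left_distributive endo_mul +%R.
Proof. by move=> f g h; apply: endoP. Qed.
Fact endo_mulDr : right_distributive endo_mul +%R.
Proof. by move=> f g h; apply: endoP => x; exact: raddfD. Qed.

HB.instance Definition _ := GRing.Zmodule_isPzRing.Build (endo A)
  endo_mulA endo_mul1 endo_mulr1 endo_mulDl endo_mulDr.

Lemma endoB f g x : (f - g) x = f x - g x.
Proof. by []. Qed.

End EndoRing.

Section EndoTopology.
Variable M : topologicalZmodType.
Implicit Types (f g h : endo M) (V : set M) (S : set (endo M)).

Definition endo_into V : set (endo M) := [set f | range f `<=` V].

(* Translates of the sets [endo_into V], V a neighborhood of zero of M. For an
   arbitrary M this is an additive group topology; it is a ring topology as soon
   as the endomorphisms of M are continuous, which holds for [bohr A]. *)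
Definition endo_nbhs f : set_system (endo M) :=
  [set S | exists2 V, nbhs (0 : M) V & [set f + h | h in endo_into V] `<=` S].

HB.instance Definition _ := hasNbhs.Build (endo M) endo_nbhs.

Lemma nbhs0_sub V : nbhs (0 : M) V ->
  exists2 W, nbhs (0 : M) W & forall x y, W x -> W y -> V (x - y).
Proof.
have := @sub_continuous M (0, 0); rewrite /continuous_at /= subr0 => cV /cV.
case=> -[/= W1 W2] [W10 W20] sW; exists (W1 `&` W2); first exact: filterI.
by move=> x y [W1x _] [_ W2y]; apply: (sW (x, y)).
Qed.

Lemma endo_into0 V : nbhs (0 : M) V -> endo_into V 0.
Proof. by move=> /nbhs_singleton V0 _ [x _ <-]. Qed.

Fact endo_nbhs_filter f : ProperFilter (nbhs f).
Proof.
apply: Build_ProperFilter_ex.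
  move=> S [V V0 sS]; exists f; apply: sS; exists 0; last by rewrite addr0.
  exact: endo_into0.
split.
- by exists setT => //; exact: filterT.
- move=> S1 S2 [V1 V10 sS1] [V2 V20 sS2]; exists (V1 `&` V2).
    exact: filterI.
  move=> _ [h hV <-]; split.
    by apply: sS1; exists h => // x /hV[].
  by apply: sS2; exists h => // x /hV[].
- by move=> S1 S2 S12 [V V0 sS1]; exists V => //; exact: subset_trans S12.
Qed.

Fact endo_nbhs_singleton f S : nbhs f S -> S f.
Proof.
move=> [V V0]; apply; exists 0; last by rewrite addr0.
exact: endo_into0.
Qed.

Lemma endo_into_sub V : nbhs (0 : M) V -> exists2 W, nbhs (0 : M) W &
  forall f g, endo_into W f -> endo_into W g -> endo_into V (f - g).
Proof.
move=> /nbhs0_sub[W W0 WV]; exists W => // f g fW gW _ [x _ <-].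
by rewrite endoB; apply: WV; [apply: fW|apply: gW]; exists x.
Qed.

Lemma endo_into_add V : nbhs (0 : M) V -> exists2 W, nbhs (0 : M) W &
  forall f g, endo_into W f -> endo_into W g -> endo_into V (f + g).
Proof.
move=> /endo_into_sub[W1 W10 WV]; have [W2 W20 WW] := endo_into_sub W10.
exists (W1 `&` W2); first exact: filterI.
move=> f g fW gW; rewrite -[g]opprK; apply: WV.
  by move=> x /fW[].
rewrite -sub0r; apply: WW; first exact: endo_into0.
by move=> x /gW[].
Qed.

Fact endo_nbhs_nbhs f S : nbhs f S -> nbhs f (nbhs^~ S).
Proof.
move=> [V /endo_into_add[W W0 WV] sS]; exists W => // _ [g gW <-].
exists W => // _ [h hW <-]; apply: sS.
by exists (g + h); [exact: WV|rewrite addrA].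
Qed.

HB.instance Definition _ := Nbhs_isNbhsTopological.Build (endo M)
  endo_nbhs_filter endo_nbhs_singleton endo_nbhs_nbhs.

Lemma endo_sub_continuous :
  continuous (fun z : endo M * endo M => z.1 - z.2).
Proof.
move=> [f g] S [V /endo_into_sub[W W0 WV] sS].
exists ([set f + h | h in endo_into W], [set g + h | h in endo_into W]) => /=.
  by split; exists W.
move=> [_ _] [/= [h1 h1W <-] [h2 h2W <-]]; apply: sS; exists (h1 - h2).
  exact: WV.
by rewrite opprD addrACA.
Qed.

HB.instance Definition _ :=
  PreTopologicalNmodule_isTopologicalZmodule.Build (endo M) endo_sub_continuous.

Lemma endo_mul_continuous : (forall f, continuous (f : M -> M)) ->
  continuous (fun z : endo M * endo M => z.1 * z.2).
Proof.
move=> cM [f g] S [V V0 sS].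
have [W W0 WV] := endo_into_add V0.
have fW0 : nbhs (0 : M) (f @^-1` W) by apply: cM; rewrite raddf0.
exists ([set f + h | h in endo_into W],
        [set g + h | h in endo_into (W `&` f @^-1` W)]) => /=.
  by split; [exists W|exists (W `&` f @^-1` W) => //; exact: filterI].
move=> [_ _] [/= [h1 h1W <-] [h2 h2W <-]]; apply: sS.
exists (h1 * (g + h2) + f * h2).
  apply: WV; first by move=> _ [x _ <-]; apply: h1W; exists ((g + h2) x).
  by move=> _ [x _ <-]; have [] := h2W (h2 x) (ex_intro2 _ _ x I erefl).
by rewrite [RHS]mulrDl [f * (g + h2)]mulrDr [LHS]addrA [LHS]addrAC.
Qed.

End EndoTopology.

Section BohrEndo.
Variable A : zmodType.

Lemma initial_precompact (f : {additive A -> A}) (t : Topological A) :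
  precompact_group_topology t ->
  precompact_group_topology
    (Topological.on (initial_topology (f : A -> Topological.Pack t))).
Proof.
move=> [[addC oppC] tb]; pose W := initial_topology (f : A -> Topological.Pack t).
have fW (x : A) V : nbhs (f x : Topological.Pack t) V -> nbhs (x : W) (f @^-1` V).
  exact: (@initial_continuous A (Topological.Pack t) f x V).
have Wf (x : A) S : nbhs (x : W) S ->
    exists2 V, nbhs (f x : Topological.Pack t) V & f @^-1` V `<=` S.
  move=> [_ [[V oV <-] Vx] VS]; exists V => //.
  by rewrite (@nbhsE (Topological.Pack t)); exists V.
split; first split.
- move=> [x y] S /Wf[V]; rewrite raddfD.
  move=> /(addC (f x, f y)) [[/= U1 U2] [U1x U2y] UV] VS.
  exists (f @^-1` U1, f @^-1` U2) => /=; first by split; exact: fW.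
  by move=> [a b] [/= Ua Ub]; apply: VS; rewrite /= raddfD; exact: (UV (f a, f b)).
- move=> x S /Wf[V]; rewrite raddfN => /(oppC (f x)) NV VS.
  by apply: filterS (fW _ _ NV) => a Va; apply: VS; rewrite /= raddfN.
- move=> S /Wf[V]; rewrite raddf0 => V0 VS.
  have [n [k kV]] := precompact_coloured (conj (conj addC oppC) tb) V0.
  apply: coloured_cover; exists n, (k \o f) => x y /kV ?.
  by apply: VS; rewrite /= raddfB.
Qed.

Lemma bohr_endo_continuous (f : endo (bohr A)) : continuous (f : bohr A -> bohr A).
Proof.
move=> x; apply/(@cvg_sup _ _ _ _ _ 
  (fmap_filter (f : bohr A -> bohr A) (@nbhs_filter (bohr A) x))).
move=> [t pt] V /= Vfx.
apply: (bohr_nbhs (initial_precompact f pt)).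
exact: (@initial_continuous A (Topological.Pack t) f x V).
Qed.

Lemma bohr_endo_mul_continuous :
  continuous (fun z : endo (bohr A) * endo (bohr A) => z.1 * z.2).
Proof. exact: endo_mul_continuous bohr_endo_continuous. Qed.

End BohrEndo.

(* The condition carried by [Discrete_ofNbhs], as a predicate. *)
Definition discrete_space (T : topologicalType) : Prop :=
  @nbhs T T = principal_filter.

Definition torsion_free (A : zmodType) : Prop :=
  forall (x : A) (n : nat), (0 < n)%N -> x *+ n = 0 -> x = 0.

(* A has a basis B: every element is, in a unique way, an integral combination
   of elements of B with finitely many nonzero coefficients. *)
Definition free_abelian (A : zmodType) : Prop :=
  exists B : set A, forall x : A, exists! c : A -> int,
    [/\ finite_set [set b | c b != 0], [set b | c b != 0] `<=` B &
        x = \sum_(b \in B) b *~ c b].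

(* Main.v *)
From HB Require Import structures.
Require Import Defs.
From mathcomp Require Import all_boot all_order all_algebra.
From mathcomp Require Import all_classical all_reals all_analysis.
From mathcomp Require Import zify lra Rstruct.

Import Order.TTheory GRing.Theory Num.Theory.

Local Open Scope classical_set_scope.
Local Open Scope card_scope.
Local Open Scope ring_scope.

Set Implicit Arguments.
Unset Strict Implicit.

(** A neighborhood base of zero in End A consists of the sets P(V), so End A is
    discrete exactly when some Bohr neighborhood V of zero contains the image
    of no nonzero endomorphism.

    Part (i). It suffices that some V contains no nonzero subgroup of A. The
    group of reals modulo 1 has a neighborhood of zero, the classes at distance
    less than 1/3 from 0, that contains no nonzero subgroup
    ([near_int_no_subgroup]). Pulling it back along an injective character of A
    gives V: the topology induced by a character is a precompact group topology
    ([char_precompact]), hence is coarser than the Bohr topology. An injective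
    character is the same as an additive map chi from A to the reals that takes
    integral values only at 0. To build it, take a maximal independent subset B
    of A, send B injectively to a family of reals whose nontrivial integral
    combinations are never integers, and extend to A: every element of A has a
    positive multiple in the span of B ([maximal_independent]), and the real
    line is divisible ([real_character]). Such a family can be indexed by the
    subsets of nat: their prefixes, coded by natural numbers, form an almost
    disjoint family of infinite sets X, and one takes the sums of 1/(n+1)! over
    n in X ([fact_sum_independent]).

    Part (ii). Given V, choose neighborhoods U 0 = V, U 1, U 2, ... with
    U (n+1) - U (n+1) contained in U n. Their intersection is a subgroup of A
    contained in V. By total boundedness each U n has a finite colouring whose
    classes have differences in U n, so the cosets of this subgroup are
    separated by countably many finite colourings and there are at most
    continuum many of them. If A is larger, the subgroup contains some z <> 0
    ([bohr_small_subgroup]), and a coordinate of the free group A, followed by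
    k |-> k z, is a nonzero endomorphism with image in V. *)

(** * An almost disjoint family of sets of natural numbers *)

(** The bits of the first n membership values of P, below a leading 1: as n
    grows these are the nodes of the binary tree on the branch P. *)
Fixpoint branch (P : set nat) (n : nat) : nat :=
  if n is m.+1 then ((branch P m).*2 + `[< P m >])%N else 1%N.

Lemma branch_gt P n : (n < branch P n)%N.
Proof. by elim: n => //= n IH; lia. Qed.

Lemma branch_inj P Q n m : branch P n = branch Q m ->
  n = m /\ forall k, (k < n)%N -> P k <-> Q k.
Proof.
elim: n m => [|n IH] [|m] /=.
- by [].
- by have := branch_gt Q m; lia.
- by have := branch_gt P n; lia.
move=> e; have /IH[nm PQ] : branch P n = branch Q m.
  by move: e; case: `[< P n >]; case: `[< Q m >] => /=; lia.
move: nm e PQ => <- e PQ.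
split=> // k; rewrite ltnS leq_eqVlt => /orP[/eqP ->|/PQ//].
apply: asbool_eq_equiv.
by move: e; case: `[< P _ >]; case: `[< Q _ >] => //=; lia.
Qed.

Definition on_branch (P : set nat) (m : nat) : bool :=
  `[< exists n, branch P n = m >].

(** The almost disjointness used below: finitely many branches other than P
    separate from P at some level, and beyond it no node of P is shared. *)
Lemma on_branch_fresh (I : eqType) (f : I -> set nat) (P : set nat)
    (s : seq I) (N : nat) :
  (forall i, i \in s -> f i <> P) ->
  exists n, [/\ (N <= n)%N, on_branch P n &
                forall i, i \in s -> ~~ on_branch (f i) n].
Proof.
move=> sP.
have [n0 n0P] : exists n0, forall i, i \in s ->
    exists2 k, (k < n0)%N & ~ (P k <-> f i k).
  elim: s sP => [|i s IH] sP; first by exists 0%N.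
  have [|n0 n0P] := IH; first by move=> j js; apply: sP; rewrite inE js orbT.
  have [k kP] : exists k, ~ (P k <-> f i k).
    apply/existsNP => e; apply: (sP i); first by rewrite inE eqxx.
    by apply/seteqP; split=> k; apply e.
  exists (maxn n0 k.+1) => j; rewrite inE => /orP[/eqP->|/n0P[l ln lP]].
    by exists k => //; rewrite leq_max ltnSn orbT.
  by exists l => //; rewrite leq_max ln.
exists (branch P (maxn n0 N)); split.
- by have := branch_gt P (maxn n0 N); lia.
- by apply/asboolP; exists (maxn n0 N).
- move=> i /n0P[k kn kP]; apply/negP => /asboolP[m /esym/branch_inj[_ e]].
  by apply/kP/e; lia.
Qed.

(** * Reals independent modulo the integers *)

Section FactorialSums.
Variable R : realType.
Implicit Types X : nat -> bool.

(** The weights are the 1/(m+1)! and not the 1/m! so that the tail from N on is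
    at most twice its first weight for every N, including N = 0. *)
Definition fact_psum X (N : nat) : R :=
  \sum_(m < N) (X m)%:R / (m.+1)`!%:R.

Definition fact_sum X : R := sup (range (fact_psum X)).

Lemma fact_psumS X N :
  fact_psum X N.+1 = fact_psum X N + (X N)%:R / (N.+1)`!%:R.
Proof. by rewrite /fact_psum big_ord_recr. Qed.

Lemma factR_gt0 n : 0 < n`!%:R :> R.
Proof. by rewrite ltr0n fact_gt0. Qed.

Lemma fact_psum_le X N k : fact_psum X N <= fact_psum X (N + k).
Proof.
elim: k => [|k IH]; first by rewrite addn0.
rewrite addnS fact_psumS; apply: le_trans IH _; rewrite lerDl.
by rewrite divr_ge0 ?ler0n.
Qed.

(** The upper bounds [fact_psum X N + 2 / (N.+1)`!] decrease with N, since
    1 + 2/(N+2) <= 2; with the increasing partial sums they enclose the sum. *)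
Lemma fact_psum_tail X N k :
  fact_psum X (N + k) + 2 / ((N + k).+1)`!%:R <=
    fact_psum X N + 2 / (N.+1)`!%:R.
Proof.
elim: k => [|k IH]; first by rewrite addn0.
rewrite addnS; apply: le_trans IH.
rewrite fact_psumS -addrA lerD2l; set n := (N + k)%N.
rewrite [in X in _ + X](factS n.+1) natrM.
have f0 := factR_gt0 n.+1; have n2 : 2 <= n.+2%:R :> R by rewrite ler_nat.
have n0 : 0 < n.+2%:R :> R by rewrite ltr0n.
have -> : 2 / (n.+2%:R * (n.+1)`!%:R) = 2 / n.+2%:R / (n.+1)`!%:R :> R.
  by rewrite invfM mulrA.
rewrite -mulrDl ler_pM2r ?invr_gt0//.
have h1 : 2 / n.+2%:R <= 1 :> R by rewrite ler_pdivrMr// mul1r.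
have h2 : (X n)%:R <= 1 :> R by rewrite lern1 leq_b1.
by apply: le_trans (lerD h2 h1) _.
Qed.

Lemma fact_sum_itv X N :
  fact_psum X N <= fact_sum X <= fact_psum X N + 2 / (N.+1)`!%:R.
Proof.
have ub M : fact_psum X M <= fact_psum X N + 2 / (N.+1)`!%:R.
  have h n : 0 <= 2 / (n.+1)`!%:R :> R by rewrite divr_ge0 ?ler0n.
  have [NM|/ltnW MN] := leqP N M.
    apply: le_trans (fact_psum_tail X N (M - N)).
    by rewrite subnKC// lerDl.
  by apply: le_trans (fact_psum_le X M (N - M)) _; rewrite subnKC// lerDl.
apply/andP; split.
  apply: ub_le_sup; last by exists N.
  by exists (fact_psum X N + 2 / (N.+1)`!%:R) => _ [M _ <-].
apply: ge_sup; first by exists (fact_psum X N), N.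
by move=> _ [M _ <-].
Qed.

Lemma fact_psum_int X N : N`!%:R * fact_psum X N \is a Num.int.
Proof.
elim: N => [|N IH]; first by rewrite /fact_psum big_ord0 mulr0 rpred0.
rewrite fact_psumS mulrDr mulrCA divff ?gt_eqF ?factR_gt0// mulr1.
by rewrite rpredD// ?rpred_nat// factS natrM -mulrA rpredM// rpred_nat.
Qed.

(** Multiplied by (N+1)!, the sum is a multiple of N+1 (see [fact_psum_int]),
    plus the digit of X at N, plus a remainder that vanishes as N grows. *)
Lemma fact_sum_rem X N : exists t : R, 0 <= t <= 2 / N.+2%:R /\
  N.+1`!%:R * fact_sum X = N.+1`!%:R * fact_psum X N + (X N)%:R + t.
Proof.
have /andP[lo hi] := fact_sum_itv X N.+1.
exists (N.+1`!%:R * (fact_sum X - fact_psum X N.+1)); split; last first.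
  have f0 := lt0r_neq0 (factR_gt0 N.+1).
  rewrite fact_psumS mulrBr mulrDr [_ * (_ / _)]mulrCA divff// mulr1.
  by rewrite addrC subrK.
have f0 := factR_gt0 N.+1; have n0 : 0 < N.+2%:R :> R by rewrite ltr0n.
apply/andP; split; first by rewrite mulr_ge0 ?subr_ge0// ltW.
apply: le_trans (_ : N.+1`!%:R * (2 / (N.+2)`!%:R) <= _).
  by rewrite ler_pM2l// lerBlDl.
by rewrite (factS N.+1) natrM invfM mulrC -!mulrA mulVf ?mulr1// gt_eqF.
Qed.

(** Suppose the combination is an integer and c i0 <> 0. Choose a large n on the
    branch of i0 and on none of the other branches, and multiply by (n+1)!. The
    remainders then contribute less than 1 and the digits contribute c i0, so by
    integrality c i0 is a multiple of n+1, although n exceeds its size. *)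
Lemma fact_sum_independent (I : eqType) (f : I -> set nat) (s : seq I)
    (c : I -> int) :
  injective f -> uniq s ->
  \sum_(i <- s) (c i)%:~R * fact_sum (on_branch (f i)) \is a Num.int ->
  forall i, i \in s -> c i = 0.
Proof.
move=> finj us sint i0 i0s; apply/eqP/negPn/negP => c0.
(* n >= 2 K bounds the remainders, at most K * 2 / (n + 2), by less than 1, and
   also forces |c i0| <= K < n + 1. *)
pose K := (\sum_(i <- s) absz (c i))%N.
have [|n [Kn Xn Xs]] := @on_branch_fresh _ f (f i0) (rem i0 s) (2 * K).
  by move=> i; rewrite mem_rem_uniq// => /andP[/= /eqP ii0 _] /finj.
have /choice[t tP] := fun i => fact_sum_rem (on_branch (f i)) n.
pose th := \sum_(i <- s) (c i)%:~R * t i.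
have thK : `|th| < 1.
  apply: le_lt_trans (ler_norm_sum _ _ _) _.
  apply: le_lt_trans (_ : \sum_(i <- s) (absz (c i))%:R * (2 / n.+2%:R) < 1).
    apply: ler_sum => i _; have [/andP[t0 tn] _] := tP i.
    rewrite normrM (ger0_norm t0) -intr_norm -abszE ler_wpM2l//.
  rewrite -mulr_suml -natr_sum mulrA ltr_pdivrMr ?ltr0n// mul1r.
  by rewrite -natrM ltr_nat mulnC; lia.
have e : n.+1`!%:R * (\sum_(i <- s) (c i)%:~R * fact_sum (on_branch (f i)))
   = n.+1%:R * (\sum_(i <- s) (c i)%:~R *
       (n`!%:R * fact_psum (on_branch (f i)) n))
     + (c i0)%:~R + th.
  have -> : (c i0)%:~R = \sum_(i <- s) (c i)%:~R * (on_branch (f i) n)%:R :> R.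
    rewrite (perm_big _ (perm_to_rem i0s)) big_cons Xn mulr1 big1_seq.
      by rewrite /= addr0.
    by move=> i /andP[_ /Xs /negbTE ->]; rewrite mulr0.
  rewrite mulr_sumr mulr_sumr -!big_split/=; apply: eq_bigr => i _.
  have [_ te] := tP i; rewrite mulrCA te factS natrM; lra.
have /intrP[J JE] : \sum_(i <- s) (c i)%:~R *
    (n`!%:R * fact_psum (on_branch (f i)) n) \is a @Num.int R.
  by apply: rpred_sum => i _; rewrite rpredM ?intr_int// fact_psum_int.
move: sint e => /intrP[z ->]; rewrite {}JE => e.
have the : th = ((n`! * n.+1)%:Z * z - n.+1%:Z * J - c i0)%:~R.
  rewrite !(rmorphB, rmorphM, rmorphD)/= -!pmulrn.
  by move: e; rewrite factS mulnC => e; rewrite natrM in e *; lra.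
move: thK; rewrite {}the -intr_norm -[1]/(1%:~R) ltr_int => th1.
have ci : c i0 = n.+1%:Z * (n`!%:Z * z - J) by lia.
have cK : (absz (c i0) <= K)%N.
  by rewrite /K (perm_big _ (perm_to_rem i0s)) big_cons leq_addr.
have : (n.+1 %| absz (c i0))%N by rewrite ci abszM dvdn_mulr.
by move/dvdn_leq; rewrite absz_gt0 => /(_ c0); lia.
Qed.

End FactorialSums.

(** * Integral combinations of finite support *)

Definition finsupp (I : choiceType) (c : I -> int) : Prop :=
  finite_set [set i | c i != 0].

Definition comb (I : choiceType) (M : zmodType) (v : I -> M) (c : I -> int) :
    M :=
  \sum_(i \in [set: I]) v i *~ c i.

Section Combinations.
Variable I : choiceType.
Implicit Types c d : I -> int.

Lemma finsupp_seq c : finsupp c ->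
  exists2 s : seq I, uniq s & forall i, c i != 0 -> i \in s.
Proof.
move=> /finite_seqP[s sE]; exists (undup s); first exact: undup_uniq.
by move=> i ci; rewrite mem_undup; have : [set` s] i by rewrite -sE.
Qed.

Lemma finsuppB c d : finsupp c -> finsupp d -> finsupp (fun i => c i - d i).
Proof.
move=> fc fd; apply: (@sub_finite_set _ _
  ([set i | c i != 0] `|` [set i | d i != 0])).
  move=> i /=; have [->|] := eqVneq (c i) 0; last by left.
  by rewrite sub0r oppr_eq0; right.
by rewrite finite_setU.
Qed.

Lemma finsuppZ c k : finsupp c -> finsupp (fun i => c i * k).
Proof.
by apply: sub_finite_set => i /=; rewrite mulf_eq0 negb_or => /andP[].
Qed.

Lemma finsupp1 (i0 : I) : finsupp (fun i => (i == i0)%:Z).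
Proof.
apply: (sub_finite_set _ (finite_set1 i0)) => i /=.
by have [->|] := eqVneq i i0.
Qed.

Variable M : zmodType.
Implicit Types v : I -> M.

Lemma comb_seq v c (s : seq I) : uniq s -> (forall i, c i != 0 -> i \in s) ->
  comb v c = \sum_(i <- s) v i *~ c i.
Proof.
move=> us sc; rewrite /comb (@fsbigE _ _ _ _ _ s)//.
  by apply: eq_bigl => i; rewrite in_setT.
move=> i _ /negP nis; have [->|/sc//] := eqVneq (c i) 0.
by rewrite mulr0z.
Qed.

Lemma comb_supp v c (B : set I) : [set i | c i != 0] `<=` B ->
  \sum_(i \in B) v i *~ c i = comb v c.
Proof.
move=> cB; apply: fsbig_widen => // i [_ Bi] /=.
by have [->|/cB//] := eqVneq (c i) 0; rewrite mulr0z.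
Qed.

Lemma combB v c d : finsupp c -> finsupp d ->
  comb v (fun i => c i - d i) = comb v c - comb v d.
Proof.
move=> /finsupp_seq[s us sc] /finsupp_seq[s' us' sd].
have ur : uniq (undup (s ++ s')) by exact: undup_uniq.
have rc i : c i != 0 -> i \in undup (s ++ s').
  by move=> /sc; rewrite mem_undup mem_cat => ->.
have rd i : d i != 0 -> i \in undup (s ++ s').
  by move=> /sd; rewrite mem_undup mem_cat orbC => ->.
rewrite (comb_seq v ur rc) (comb_seq v ur rd) (comb_seq v ur); last first.
  move=> i; have [->|/rc//] := eqVneq (c i) 0.
  by rewrite sub0r oppr_eq0 => /rd.
by rewrite -sumrB; apply: eq_bigr => i _; rewrite mulrzBr.
Qed.

Lemma combZ v c k : finsupp c -> comb v (fun i => c i * k) = comb v c *~ k.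
Proof.
move=> /finsupp_seq[s us sc]; rewrite !(comb_seq _ us)//.
  by rewrite mulrz_suml; apply: eq_bigr => i _; rewrite mulrzA.
by move=> i; rewrite mulf_eq0 negb_or => /andP[/sc].
Qed.

Lemma comb1 v (i0 : I) : comb v (fun i => (i == i0)%:Z) = v i0.
Proof.
have h i : (i == i0)%:Z != 0 -> i \in [:: i0].
  by rewrite inE; have [] := eqVneq i i0.
by rewrite (comb_seq v _ h)// big_seq1 eqxx.
Qed.

Lemma comb0 v c : (forall i, c i = 0) -> comb v c = 0.
Proof. by move=> c0; rewrite /comb fsbig1// => i _; rewrite c0 mulr0z. Qed.

End Combinations.

(** * Extending a map from a maximal independent set *)

Section MaximalIndependent.
Variable A : zmodType.

Definition independent (B : set A) : Prop := forall c : A -> int,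
  finsupp c -> [set b | c b != 0] `<=` B -> comb id c = 0 -> forall b, c b = 0.

(** A relation involves finitely many elements, so in a chain it already lives
    in one member. *)
Lemma independent_bigcup (F : set (set A)) :
  F `<=` independent -> total_on F subset ->
  independent (\bigcup_(X in F) X).
Proof.
move=> Find Ftot c fc cF c0.
have [s us sc] := finsupp_seq fc.
have [F0|/set0P[X0 FX0]] := eqVneq F set0.
  move=> b; apply/eqP/negPn/negP => /cF; rewrite F0 => -[X]; exact.
suff [X FX sX] : exists2 X, F X &
    forall b, b \in s -> c b != 0 -> X b.
  by apply: (Find X) => // b /= cb; apply: sX => //; exact: sc.
elim: s {us sc} => [|a s [X FX sX]]; first by exists X0.
have [ca|/cF[Y FY Ya]] := eqVneq (c a) 0.
  by exists X => // b; rewrite inE => /orP[/eqP->|/sX//]; rewrite ca eqxx.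
have [XY|YX] := Ftot X Y FX FY.
  by exists Y => // b; rewrite inE => /orP[/eqP->//|bs cb]; exact/XY/sX.
by exists X => // b; rewrite inE => /orP[/eqP-> _|/sX//]; exact: YX.
Qed.

(** An element outside a maximal B satisfies with B a relation, in which its own
    coefficient cannot vanish because B is independent. *)
Lemma maximal_independent : exists2 B, independent B &
  forall a, exists m c, [/\ (0 < m)%N, finsupp c, [set b | c b != 0] `<=` B &
    a *+ m = comb id c].
Proof.
have [B [Bind Bmax]] := Zorn_bigcup independent_bigcup.
exists B => // a; have [Ba|nBa] := pselect (B a).
  exists 1%N, (fun b => (b == a)%:Z); split => //; first exact: finsupp1.
    by move=> b /=; have [->|] := eqVneq b a.
  by rewrite comb1.
have : ~ independent (a |` B).
  apply: Bmax; split; last by move=> /(_ a); apply: contra_not nBa; apply; left.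
  by right.
move=> /existsNP[c /not_implyP[fc /not_implyP[cB /not_implyP[c0]]]].
move=> /existsNP[b0 cb0].
have ca : c a != 0.
  apply/eqP => ca; apply/cb0/Bind => // b cb.
  by case: (cB _ cb) => // ba; move: cb; rewrite /= ba ca eqxx.
pose k := sgz (c a).
(* Solving the relation for a: the coefficient of a is moved to the left-hand
   side, and the relation is multiplied by the sign of that coefficient. *)
exists (absz (c a)), (fun b => ((b == a)%:Z * c a - c b) * k); split.
- by rewrite absz_gt0.
- by apply/finsuppZ/finsuppB => //; apply/finsuppZ/finsupp1.
- move=> b /=; rewrite mulf_eq0 negb_or => /andP[+ _].
  have [->|ba] := eqVneq b a; first by rewrite mul1r subrr eqxx.
  by rewrite mul0r sub0r oppr_eq0 => /cB[ab|//]; rewrite ab eqxx in ba.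
rewrite combZ; last by apply/finsuppB => //; apply/finsuppZ/finsupp1.
rewrite combB//; last by apply/finsuppZ/finsupp1.
rewrite c0 subr0 combZ; last exact: finsupp1.
by rewrite comb1 -mulrzA mulrC -abszEsg pmulrn.
Qed.

End MaximalIndependent.

(** An injective character into the reals modulo 1, lifted to the reals. The map
    chi extends the restriction of rho to a maximal independent set B: if a *+ m
    is the combination c of B, then chi a is the combination c of the rho b,
    divided by m. Torsion-freeness enters at the end: an integral chi a makes c
    vanish, so that a *+ m = 0. *)
Lemma real_character (R : realType) (A : zmodType) (rho : A -> R) :
  torsion_free A ->
  (forall c, finsupp c -> comb rho c \is a Num.int -> forall a, c a = 0) ->
  exists2 chi : A -> R, {morph chi : a b / a - b} &
    forall a, chi a \is a Num.int -> a = 0.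
Proof.
move=> tf rho_int; have [B Bind Bgen] := maximal_independent A.
(* The graph of chi. It is a subgroup of A * R, so that it is single-valued as
   soon as it is so at 0. *)
pose G a r := exists m c, [/\ (0 < m)%N, finsupp c, [set b | c b != 0] `<=` B,
  a *+ m = comb id c & r *+ m = comb rho c].
have GB a r a' r' : G a r -> G a' r' -> G (a - a') (r - r').
  move=> [m [c [m0 fc cB ac rc]]] [m' [c' [m0' fc' cB' ac' rc']]].
  exists (m * m')%N, (fun b => c b * m'%:Z - c' b * m%:Z); split.
  - by rewrite muln_gt0 m0.
  - by apply: finsuppB; exact: finsuppZ.
  - move=> b; have [cb|/cB//] := eqVneq (c b) 0.
    rewrite /= cb mul0r sub0r oppr_eq0 mulf_eq0 negb_or => /andP[/cB']//.
  - rewrite combB ?combZ//; try exact: finsuppZ.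
    by rewrite -ac -ac' -!pmulrn -!mulrnA mulrnBl [(m' * m)%N]mulnC.
  - rewrite combB ?combZ//; try exact: finsuppZ.
    by rewrite -rc -rc' -!pmulrn -!mulrnA mulrnBl [(m' * m)%N]mulnC.
have G0 r : G 0 r -> r = 0.
  move=> [m [c [m0 fc cB /esym]]]; rewrite mul0rn => c0.
  rewrite (comb0 rho (Bind c fc cB c0)) => /eqP.
  by rewrite mulrn_eq0 eqn0Ngt m0 => /eqP.
have /choice[chi chiP] : forall a, exists r, G a r.
  move=> a; have [m [c [m0 fc cB ac]]] := Bgen a.
  exists (comb rho c / m%:R), m, c; split=> //.
  by rewrite -[(_ / _) *+ m]mulr_natr divfK// pnatr_eq0 -lt0n.
exists chi => [a b|a /intrP[z chiz]].
  have := GB _ _ _ _ (chiP (a - b)) (GB _ _ _ _ (chiP a) (chiP b)).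
  by rewrite subrr => /G0/eqP; rewrite subr_eq0 => /eqP.
have [m [c [m0 fc cB ac chic]]] := chiP a.
apply: (tf a m m0); rewrite ac comb0//; apply: (rho_int c fc).
by rewrite -chic chiz rpredMn// intr_int.
Qed.

(** * The precompact topology induced by a character *)

Section CharacterTopology.
Variables (R : realType) (A : zmodType) (chi : {additive A -> R}).

Definition near_int (e : R) : set A :=
  [set x | exists n : int, `|chi x - n%:~R| < e].

Lemma near_int0 e : 0 < e -> near_int e 0.
Proof. by exists 0; rewrite raddf0 subrr normr0. Qed.

Lemma near_intD e x y : near_int (e / 2) x -> near_int (e / 2) y ->
  near_int e (x + y).
Proof.
move=> [n xn] [m ym]; exists (n + m).
have -> : chi (x + y) - (n + m)%:~R = (chi x - n%:~R) + (chi y - m%:~R).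
  by rewrite raddfD rmorphD /=; lra.
by apply: le_lt_trans (ler_normD _ _) _; lra.
Qed.

(** The colour of x is the one of N intervals of length 1/N that contains the
    fractional part of chi x, where 1/N < e. *)
Lemma near_int_coloured e : 0 < e -> coloured (near_int e).
Proof.
move=> e0; pose N := (Num.truncn e^-1).+1.
have eN : e^-1 < N%:R by exact: truncnS_gt.
have N0 : 0 < N%:R :> R by rewrite ltr0n.
pose fr x : R := chi x - (Num.floor (chi x))%:~R.
have fr_itv x : 0 <= fr x < 1.
  by have := floor_itv (chi x); rewrite rmorphD /fr /=; lra.
exists N, (fun x => inord (Num.truncn (N%:R * fr x))) => x y.
have ltN z : (Num.truncn (N%:R * fr z) < N)%N.
  have /andP[z0 z1] := fr_itv z; rewrite -(ltr_nat R).
  apply: le_lt_trans (_ : _ <= N%:R * fr z) _.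
    by rewrite truncn_le mulr_ge0.
  by rewrite gtr_pMr.
move=> /(congr1 (@nat_of_ord _)); rewrite /= !inordK// => txy.
have /andP[x0 _] := fr_itv x; have /andP[y0 _] := fr_itv y.
have := truncn_itv (mulr_ge0 (ltW N0) x0).
have := truncn_itv (mulr_ge0 (ltW N0) y0).
rewrite txy -natr1 => /andP[hy1 hy2] /andP[hx1 hx2].
have N1 : `|N%:R * (fr x - fr y)| < 1.
  by rewrite mulrBr ltr_norml; apply/andP; split; lra.
exists (Num.floor (chi x) - Num.floor (chi y)).
have -> : chi (x - y) - (Num.floor (chi x) - Num.floor (chi y))%:~R =
    fr x - fr y.
  by rewrite raddfB rmorphB /= /fr; lra.
move: N1; rewrite normrM gtr0_norm// -ltr_pdivlMl// mulr1 => /lt_trans; apply.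
by rewrite -[e]invrK ltf_pV2// posrE invr_gt0.
Qed.

(** Let d be the signed distance from chi x to the nearest integer. By induction
    |n d| < 1/3 for all n: then |(n+1) d| < 2/3, and a real of this size within
    1/3 of an integer can only be near 0. By the archimedean property d = 0. *)
Lemma near_int_no_subgroup x : (forall n, near_int 3^-1 (x *+ n)) ->
  chi x \is a Num.int.
Proof.
move=> xn; have [n0] := xn 1%N; rewrite mulr1n; set d := chi x - _ => d3.
suff d0 : d = 0 by apply/intrP; exists n0; apply/subr0_eq.
have dn n : `|d *+ n| < 3^-1.
  elim: n => [|n IH]; first by rewrite mulr0n normr0 invr_gt0.
  have [m] := xn n.+1.
  have -> : chi (x *+ n.+1) - m%:~R = d *+ n.+1 - (m - n0 *+ n.+1)%:~R.
    by rewrite raddfMn /d mulrnBl rmorphB rmorphMn /=; lra.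
  set k := m - _ => hk.
  have dn1 : `|d *+ n.+1| < 2 * 3^-1.
    by rewrite mulrS; apply: le_lt_trans (ler_normD _ _) _; lra.
  have k1 : `|k%:~R : R| < 1.
    rewrite -[k%:~R](subrK (d *+ n.+1)); apply: le_lt_trans (ler_normD _ _) _.
    by rewrite distrC; lra.
  move: k1 hk; rewrite -intr_norm -[1]/(1%:~R) ltr_int => k1.
  by have -> : k = 0; [lia|rewrite subr0].
apply/eqP/negPn/negP => dn0; have dgt0 : 0 < `|d| by rewrite normr_gt0.
have := dn (Num.truncn `|d|^-1).+1; rewrite normrMn -mulr_natr.
have : 1 <= `|d| * (Num.truncn `|d|^-1).+1%:R.
  by rewrite -ler_pdivrMl// mulr1 ltW// truncnS_gt.
lra.
Qed.

(** A copy of A, to carry a topology that depends on chi. *)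
Definition char_space : Type := A.

HB.instance Definition _ := GRing.Zmodule.on char_space.

Definition char_nbhs (x : char_space) : set_system char_space :=
  [set S | exists2 e : R, 0 < e & [set x + h | h in near_int e] `<=` S].

HB.instance Definition _ := hasNbhs.Build char_space char_nbhs.

Lemma near_int_le (e e' : R) : e <= e' -> near_int e `<=` near_int e'.
Proof. by move=> ee' x [n xn]; exists n; exact: lt_le_trans ee'. Qed.

Fact char_nbhs_filter x : ProperFilter (nbhs (x : char_space)).
Proof.
apply: Build_ProperFilter_ex.
  move=> S [e e0 sS]; exists x; apply: sS; exists 0; last by rewrite addr0.
  exact: near_int0.
split.
- by exists 1.
- move=> S1 S2 [e1 e10 sS1] [e2 e20 sS2]; exists (Num.min e1 e2).
    by rewrite lt_min e10.
  move=> _ [h hV <-]; split.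
    by apply: sS1; exists h => //; apply: near_int_le hV; rewrite ge_min lexx.
  apply: sS2; exists h => //; apply: near_int_le hV.
  by rewrite ge_min lexx orbT.
- by move=> S1 S2 S12 [e e0 sS1]; exists e => //; exact: subset_trans S12.
Qed.

Fact char_nbhs_singleton (x : char_space) S : nbhs x S -> S x.
Proof.
by move=> [e e0]; apply; exists 0; [exact: near_int0|rewrite addr0].
Qed.

Fact char_nbhs_nbhs (x : char_space) S : nbhs x S -> nbhs x (nbhs^~ S).
Proof.
move=> [e e0 sS]; exists (e / 2); first by rewrite divr_gt0.
move=> _ [g gW <-]; exists (e / 2); first by rewrite divr_gt0.
move=> _ [h hW <-]; apply: sS; exists (g + h); last by rewrite addrA.
exact: near_intD.
Qed.

HB.instance Definition _ := Nbhs_isNbhsTopological.Build char_space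
  char_nbhs_filter char_nbhs_singleton char_nbhs_nbhs.

Lemma char_precompact :
  precompact_group_topology (Topological.on char_space : Topological A).
Proof.
have e2 (e : R) : 0 < e -> 0 < e / 2 by move=> ?; rewrite divr_gt0.
split; first split.
- move=> [x y] S [e e0 sS].
  exists ([set x + h | h in near_int (e / 2)],
    [set y + h | h in near_int (e / 2)]).
    by split; exists (e / 2) => //; exact: e2.
  move=> [_ _] [/= [h1 hh1 <-] [h2 hh2 <-]]; apply: sS.
  by exists (h1 + h2); [exact: near_intD|rewrite addrACA].
- move=> x S [e e0 sS]; exists e => // _ [h [n hn] <-]; apply: sS.
  exists (- h); last by rewrite opprD.
  by exists (- n); rewrite raddfN rmorphN -opprD normrN.
- move=> S [e e0 sS]; apply: coloured_cover.
  have [n [k kP]] := near_int_coloured e0; exists n, k => x y /kP xy.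
  by apply: sS; exists (x - y) => //; rewrite add0r.
Qed.

End CharacterTopology.

Lemma bohr_near_int (R : realType) (A : zmodType) (chi : {additive A -> R})
    (e : R) : 0 < e -> nbhs (0 : bohr A) (near_int chi e).
Proof.
move=> e0; apply: (bohr_nbhs (char_precompact chi)).
by exists e => // _ [h hh <-]; rewrite add0r.
Qed.

(** * Discreteness *)

Lemma discrete_endo_bohr_of_char (R : realType) (A : zmodType)
    (chi : {additive A -> R}) :
  (forall a, chi a \is a Num.int -> a = 0) -> discrete_space (endo (bohr A)).
Proof.
move=> chi_inj; apply/funext => f; apply/seteqP; split=> S.
  by move=> /nbhs_singleton/principal_filterP.
move=> /principal_filterP Sf; exists (near_int chi 3^-1).
  by apply: bohr_near_int; rewrite invr_gt0.
move=> _ [h hV <-]; suff -> : h = 0 by rewrite addr0.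
apply: endoP => x; apply: chi_inj; apply: near_int_no_subgroup => n.
by apply: hV; exists (x *+ n) => //; rewrite raddfMn.
Qed.

Lemma injective_setP (A : Type) :
  reflect (exists f : A -> set nat, injective f) ([set: A] #<= [set: set nat]).
Proof.
apply: (iffP pcard_injP) => -[f finj]; exists f.
  by move=> x y; apply: finj; rewrite in_setT.
by move=> x y _ _ /finj.
Qed.

(** * Nondiscreteness *)

(** The z in all the neighborhoods U n below form a subgroup contained in V. It
    is nonzero because the sequence of colours of x, coded as a set of natural
    numbers, cannot separate the points of a group larger than the continuum.
    This replaces a description of the Bohr neighborhoods by characters. *)
Lemma bohr_small_subgroup (A : zmodType) (V : set (bohr A)) :
  ~~ ([set: A] #<= [set: set nat]) -> nbhs (0 : bohr A) V ->
  exists2 z : A, z <> 0 & forall k : int, V (z *~ k).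
Proof.
move=> Abig V0.
have /choice[W WP] : forall U : set (bohr A), exists W, nbhs (0 : bohr A) U ->
    nbhs (0 : bohr A) W /\ forall x y, W x -> W y -> U (x - y).
  move=> U; have [|nU] := pselect (nbhs (0 : bohr A) U).
    by move=> /nbhs0_sub[W W0 WU]; exists W.
  by exists setT.
pose U n := iter n W V.
have U0 n : nbhs (0 : bohr A) (U n) by elim: n => //= n /WP[].
have US n x y : U n.+1 x -> U n.+1 y -> U n (x - y).
  by have [_] := WP _ (U0 n); exact.
have /choice[col colP] : forall n, exists k : A -> nat,
    forall x y, k x = k y -> U n (x - y).
  move=> n; have [N [k kP]] := precompact_coloured (bohr_precompact A) (U0 n).
  by exists (fun x => k x) => x y /ord_inj/kP.
have [x [y [xy colE]]] : exists x y, x <> y /\ forall n, col n x = col n y.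
  apply: contrapT => nxy; move/negP: Abig; apply; apply/injective_setP.
  exists (fun x => [set m | exists n, m = pickle (n, col n x)]) => x y exy.
  apply: contrapT => ne; apply: nxy; exists x, y; split=> // n.
  have : [set m | exists n, m = pickle (n, col n y)] (pickle (n, col n x)).
    by rewrite -exy; exists n.
  by move=> [n' /(pcan_inj pickleK)[<-]].
exists (x - y); first by move=> /subr0_eq.
pose N (z : A) := forall n, U n z.
have NB u v : N u -> N v -> N (u - v) by move=> Nu Nv n; apply: US.
have N0 : N 0 by move=> n; exact: (nbhs_singleton (U0 n)).
have NN u : N u -> N (- u) by rewrite -sub0r; exact: NB.
have Nxy : N (x - y) by move=> n; exact/colP.
have Nn k : N ((x - y) *+ k).
  elim: k => [|k IH]; first by rewrite mulr0n.
  by rewrite mulrSr -[_ *+ k + _]opprK opprD; apply/NN/NB => //; exact: NN.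
move=> k; suff : N ((x - y) *~ k) by move=> /(_ 0%N).
by case: k => k; [exact: Nn|apply: NN; exact: Nn].
Qed.

(** The coordinate along an element b of the basis; it is additive because
    coordinates are unique. A nonzero z provides such a b. *)
Lemma free_abelian_coord (A : zmodType) (z : A) : free_abelian A -> z <> 0 ->
  exists (p : A -> int) (b : A), {morph p : x y / x - y} /\ p b = 1.
Proof.
move=> [B Bbasis] z0.
have /choice[coord cP] := Bbasis.
have fc x : finsupp (coord x) by have [[]] := cP x.
have cB x : [set b | coord x b != 0] `<=` B by have [[]] := cP x.
have cE x : x = comb id (coord x).
  by rewrite -(comb_supp id (cB x)); have [[]] := cP x.
have coord_uniq x c : finsupp c -> [set b | c b != 0] `<=` B ->
    x = comb id c -> coord x = c.
  by move=> f1 f2 f3; have [_] := cP x; apply; split;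
      rewrite // [LHS]f3 -(comb_supp id f2).
have [b0 Bb0] : exists b, B b.
  have [b cb] : exists b, coord z b != 0.
    apply: contrapT => /forallNP nb; apply: z0.
    rewrite (cE z); apply: comb0 => b.
    by apply/eqP/negPn/negP; exact: nb.
  by exists b; exact: cB cb.
exists (coord^~ b0), b0; split=> [x y|].
  rewrite (coord_uniq (x - y) (fun b => coord x b - coord y b))//.
  - exact: finsuppB.
  - move=> b /=; have [cb|/cB//] := eqVneq (coord x b) 0.
    by rewrite cb sub0r oppr_eq0 => /cB.
  - by rewrite combB// -!cE.
rewrite (coord_uniq b0 (fun b => (b == b0)%:Z)) ?eqxx//; first exact: finsupp1.
  by move=> b /=; have [->|] := eqVneq b b0.
by rewrite comb1.
Qed.

Lemma nondiscrete_endo_bohr (A : zmodType) :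
  free_abelian A -> ~~ ([set: A] #<= [set: set nat]) ->
  ~ discrete_space (endo (bohr A)).
Proof.
move=> Afree Abig disc.
have [V V0 V1] : nbhs (0 : endo (bohr A)) [set 0].
  by rewrite [nbhs]disc.
have [z z0 zV] := bohr_small_subgroup Abig V0.
have [p [b [pB pb]]] := free_abelian_coord Afree z0.
pose f (x : bohr A) : bohr A := (z : A) *~ p x.
have fB : zmod_morphism f by move=> x y; rewrite /f pB mulrzBr.
pose F : {additive bohr A -> bohr A} :=
  HB.pack f (GRing.isZmodMorphism.Build _ _ f fB).
have : (F : endo (bohr A)) = 0.
  by apply: V1; exists F; [move=> _ [x _ <-]; exact: zV|rewrite add0r].
move=> /(congr1 (fun g : endo (bohr A) => (g : A -> A) b)).
by rewrite /= /f pb.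
Qed.

Theorem theorem8 (A : zmodType) :
  (torsion_free A -> [set: A] #<= [set: set nat] ->
     discrete_space (endo (bohr A))) /\
  (free_abelian A ->
     [set: set nat] #<= [set: A] /\ ~~ ([set: A] #<= [set: set nat]) ->
     ~ discrete_space (endo (bohr A))).
Proof.
split=> [tf /injective_setP[f finj]|Afree [_ Abig]]; last first.
  exact: nondiscrete_endo_bohr.
pose R : realType := Rdefinitions.R.
have [c|chi chiB chi_int] :=
  @real_character R A (fun a => fact_sum R (on_branch (f a))) tf.
  move=> /finsupp_seq[s us sc]; rewrite (comb_seq _ us sc) => sint a.
  apply/eqP/negPn/negP => ca; move/negP: (ca); apply; apply/eqP.
  apply: (fact_sum_independent finj us (c := c)) (sc _ ca).
  move: sint; congr (_ \is a _); apply: eq_bigr => i _.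
  by rewrite mulrC -mulrzr.
pose X : {additive A -> R} :=
  HB.pack chi (GRing.isZmodMorphism.Build _ _ chi chiB).
exact: (@discrete_endo_bohr_of_char R A X).
Qed.
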